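(* Let $\Phi^M_{AB}$ be a maximally entangled state of Schmidt rank $M$. Then $$E_\kappa(\Phi^M_{AB})=\log_2 M.$$ Furthermore, for any bipartite state $\rho_{AB}$, the following bound holds: $$E_\kappa(\rho_{AB})\le\log_2\min\{d_A,d_B\},$$ where $d_A$ and $d_B$ denote the dimensions of systems $A$ and $B$, respectively.
   Context: A bipartite state $\rho_{AB}$ is a positive semi-definite operator of unit trace on $\mathcal{H}_A\otimes\mathcal{H}_B$. The partial transpose with respect to a fixed orthonormal basis $\{|i\rangle_B\}_i$ is the linear map $T_B(X_{AB})=X_{AB}^{T_B}:=\sum_{i,j}(I_A\otimes|i\rangle\langle j|_B)X_{AB}(I_A\otimes|i\rangle\langle j|_B)$. For $M\in\mathbb{N}=\{1,2,\dots\}$, the maximally entangled state of Schmidt rank $M$ is $\Phi^M_{AB}:=\frac1M\sum_{i,j=1}^M|i\rangle\langle j|_A\otimes|i\rangle\langle j|_B$, where $A,B$ have dimension $M$ with orthonormal bases $\{|i\rangle_A\}_i$, $\{|i\rangle_B\}_i$. $\kappa$-entanglement: $E_\kappa(\rho_{AB}):=\inf\{\log_2\operatorname{Tr}[S_{AB}]: S_{AB}\ge0,\ -S_{AB}^{T_B}\le\rho_{AB}^{T_B}\le S_{AB}^{T_B}\}$, the infimum being over trace-class operators $S_{AB}$ (with value $+\infty$ if the feasible set is empty). *)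

(* Defs.v *)
From mathcomp Require Import all_boot all_order all_algebra.
From mathcomp Require Import all_classical all_reals all_analysis.
From mathcomp.real_closed Require Import complex.
From mathcomp.analysis.showcase Require Import summability.

Set Implicit Arguments.
Unset Strict Implicit.
Unset Printing Implicit Defensive.

Import Order.TTheory GRing.Theory Num.Theory.
Import numFieldNormedType.Exports.

Local Open Scope classical_set_scope.
Local Open Scope ring_scope.
Local Open Scope complex_scope.

(* A Hilbert space with a fixed orthonormal basis indexed by K (of arbitrary
   cardinality) is represented as l^2(K), inside the space K -> R[i] of all
   families of complex numbers. The tensor product of l^2(I) and l^2(J) is
   l^2(I * J), with basis vectors |i>|j> indexed by the pairs (i, j). *)

Definition sqnorm (R : realType) (K : choiceType) (v : K -> R[i]) : \bar R :=
  \esum_(k in [set: K]) ((complex.Re (v k)) ^+ 2 + (complex.Im (v k)) ^+ 2)%:E.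

Definition ell2 (R : realType) (K : choiceType) : set (K -> R[i]) :=
  [set v | (sqnorm v < +oo)%E].

(* The unordered sum [sum] is the limit of the sums over finite subsets of K;
   it converges absolutely when u and v are square-summable. *)
Definition inner (R : realType) (K : choiceType) (u v : K -> R[i]) : R[i] :=
  sum (fun k => (u k)^* * v k : R[i]^o).

Definition ket (R : realType) (K : choiceType) (k : K) : K -> R[i] :=
  fun m => (m == k)%:R.

(* An operator is a total map on families; only its restriction to l^2(K) is
   meaningful, and every notion below only evaluates it there. *)
Definition op (R : realType) (K : choiceType) := (K -> R[i]) -> (K -> R[i]).

Definition bounded_linear (R : realType) (K : choiceType) (X : op R K) : Prop :=
  (forall (a : R[i]) (u v : K -> R[i]), ell2 u -> ell2 v ->
     X (fun k => a * u k + v k) = (fun k => a * X u k + X v k)) /\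
  (exists c : R, forall v : K -> R[i], ell2 v ->
     (sqnorm (X v) <= c%:E * sqnorm v)%E).

(* In the order of R[i], 0 <= z says that z is real and nonnegative. *)
Definition op_le (R : realType) (K : choiceType) (X Y : op R K) : Prop :=
  forall v : K -> R[i], ell2 v -> 0 <= inner v (fun k => Y v k - X v k).

Definition op_opp (R : realType) (K : choiceType) (X : op R K) : op R K :=
  fun v k => - X v k.

Definition op_zero (R : realType) (K : choiceType) : op R K := fun _ _ => 0.

Definition positive (R : realType) (K : choiceType) (X : op R K) : Prop :=
  bounded_linear X /\ op_le (@op_zero R K) X.

(* Trace of a positive operator, as an element of [0, +oo]. A positive
   operator is its own absolute value, so that it is trace-class if and only if
   this is finite. *)
Definition trace (R : realType) (K : choiceType) (X : op R K) : \bar R :=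
  \esum_(k in [set: K]) (complex.Re (inner (ket R k) (X (ket R k))))%:E.

Definition positive_trace_class (R : realType) (K : choiceType) (X : op R K) :
  Prop := positive X /\ (trace X < +oo)%E.

Definition state (R : realType) (I J : choiceType) (rho : op R (I * J)%type) :
  Prop := positive rho /\ trace rho = 1%E.

(* The operator |k><l|. *)
Definition ketbra (R : realType) (K : choiceType) (k l : K) : op R K :=
  fun v m => v l * ket R k m.

(* The operator (identity on A) (x) |i><j|. *)
Definition id_ketbra (R : realType) (I J : choiceType) (i j : J) :
  op R (I * J)%type := fun v p => v (p.1, j) * ket R i p.2.

(* sum_(i, j) (1 (x) |i><j|) X (1 (x) |i><j|). The sum over pairs (i, j) is
   taken coordinatewise in the output; it converges absolutely for X
   trace-class (more generally Hilbert-Schmidt) and v square-summable. *)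
Definition ptranspose (R : realType) (I J : choiceType)
    (X : op R (I * J)%type) : op R (I * J)%type :=
  fun v p => sum (fun ij : J * J =>
    id_ketbra ij.1 ij.2 (X (id_ketbra ij.1 ij.2 v)) p : R[i]^o).

Definition log2 (R : realType) (x : \bar R) : \bar R :=
  (lne x * ((ln 2)^-1)%:E)%E.

Definition kappa_feasible (R : realType) (I J : choiceType)
    (rho : op R (I * J)%type) : set (op R (I * J)%type) :=
  [set S | [/\ positive_trace_class S,
               op_le (op_opp (ptranspose S)) (ptranspose rho) &
               op_le (ptranspose rho) (ptranspose S)]].

(* ereal_inf set0 = +oo. *)
Definition kappa_entanglement (R : realType) (I J : choiceType)
    (rho : op R (I * J)%type) : \bar R :=
  ereal_inf [set log2 (trace S) | S in kappa_feasible rho].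

(* |i><j| (x) |i><j| is |ii><jj|. *)
Definition max_entangled (R : realType) (M : nat) :
    op R ('I_M * 'I_M)%type :=
  fun v p => M%:R^-1 * \sum_(i < M) \sum_(j < M) ketbra (i, i) (j, j) v p.

(* Hilbert-space dimension of l^2(K), with value +oo if K is infinite. *)
Definition hdim (R : realType) (K : choiceType) : \bar R := counting [set: K].

(* Main.v *)
(* If n is the dimension of B, then S = rho_A (x) 1 is feasible and has trace n.
   Indeed S is its own partial transpose, and, with u_ab := (1 (x) |a><b|) v,
   <v, (S +- rho^T_B) v> = 1/2 sum_(a, b) <u_ab +- u_ba, rho (u_ab +- u_ba)>.
   If A is the finite-dimensional factor, the same computation with 1 (x) rho_B
   bounds the partial transpose over A, which is the entrywise complex conjugate
   of the one over B.
   Conversely, the partial transpose of the maximally entangled state is M^-1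
   times the swap. Testing the two constraints on |ij> + |ji> and |ij> - |ji>
   gives <ij|S|ij> + <ji|S|ji> >= 2 / M, and summing over i and j, Tr S >= M. *)

Require Import Defs.
From mathcomp Require Import all_boot all_order all_algebra.
From mathcomp Require Import ring lra finmap.
From mathcomp Require Import all_classical all_reals all_analysis.
From mathcomp.real_closed Require Import complex.
From mathcomp.analysis.showcase Require Import summability.

Set Implicit Arguments.
Unset Strict Implicit.
Unset Printing Implicit Defensive.

Import Order.TTheory GRing.Theory Num.Theory.
Import numFieldNormedType.Exports.

Local Open Scope classical_set_scope.
Local Open Scope complex_scope.
Local Open Scope ring_scope.

#[local] Existing Instance totally_filter.

(** * Unordered sums *)

Section HasSum.
Variables (C : numFieldType) (V : normedModType C) (K : choiceType).
Implicit Types (f g : K -> V) (l m : V).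

Lemma partial_sumE f (A : {fset K}) : partial_sum f A = \sum_(k <- A) f k.
Proof. by rewrite /partial_sum big_seq_fsetE. Qed.

(** [sum] is a [lim], which takes a default value when the partial sums diverge. This relation
    carries the convergence along, and linearity is proved for it. *)
Definition has_sum f l : Prop := partial_sum f @ totally --> l.

Lemma has_sum_sum f l : has_sum f l -> sum f = l.
Proof. exact: (cvg_lim (@norm_hausdorff _ _)). Qed.

Lemma has_sumD f g l m :
  has_sum f l -> has_sum g m -> has_sum (fun k => f k + g k) (l + m).
Proof.
move=> fl gm; rewrite /has_sum.
rewrite (_ : partial_sum _ = partial_sum f \+ partial_sum g); first exact: cvgD.
by apply/funext => A /=; rewrite !partial_sumE big_split.
Qed.

Lemma has_sumZ f (c : C) l :
  has_sum f l -> has_sum (fun k => c *: f k) (c *: l).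
Proof.
move=> fl; rewrite /has_sum.
rewrite (_ : partial_sum _ = c \*: partial_sum f); first exact: cvgZl_tmp.
by apply/funext => A /=; rewrite !partial_sumE scaler_sumr.
Qed.

Lemma has_sum_big (F : finType) (f : F -> K -> V) (l : F -> V) :
  (forall a, has_sum (f a) (l a)) ->
  has_sum (fun k => \sum_a f a k) (\sum_a l a).
Proof.
move=> fl; elim: (index_enum F) => [|a s IH].
  rewrite big_nil /has_sum (_ : partial_sum _ = fun=> 0); first exact: cvg_cst.
  apply/funext => A; rewrite partial_sumE big1// => k _.
  by rewrite big_nil.
under [X in has_sum X _]eq_fun do rewrite big_cons.
by rewrite big_cons; exact: has_sumD.
Qed.

End HasSum.

Section UnorderedSum.
Variable R : realType.
Implicit Types K J : choiceType.

Lemma has_sumJ K (f : K -> R[i]) (l : R[i]) :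
  has_sum (f : K -> R[i]^o) l -> has_sum (fun k => (f k)^* : R[i]^o) l^*.
Proof.
move=> /cvgrPdist_lt fl; apply/cvgrPdist_lt => e e0.
apply: filterS (fl e e0) => A /=.
by rewrite !partial_sumE -rmorph_sum -rmorphB /= norm_conjC.
Qed.

(** Links the supremum of finite sums with the limit over finite sets: a finite set whose sum is
    within [e] of the supremum can only be improved by adding nonnegative terms. *)
Lemma has_sum_ge0 K (g : K -> R) : (forall k, 0 <= g k) ->
  (\esum_(k in [set: K]) (g k)%:E < +oo)%E ->
  has_sum (fun k => (g k)%:C : R[i]^o)
    (fine (\esum_(k in [set: K]) (g k)%:E))%:C.
Proof.
move=> g0 goo; set s := esum _ _ in goo *.
have s0 : (0 <= s)%E by apply: esum_ge0 => k _; rewrite lee_fin.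
have sE : (fine s)%:E = s by rewrite fineK// ge0_fin_numE.
(* A positive element of [R[i]] is real, so the imaginary part [e'] of the tolerance is 0. *)
apply/cvgrPdist_lt => -[e e'] /=; rewrite ltcE /= => /andP[/eqP -> e0].
have : ((fine s - e)%:E < s)%E by rewrite -[ltRHS]sE lte_fin ltrBlDr ltrDl.
move=> /ereal_sup_gt[_ [A [finA _] <-]].
rewrite fsbig_finite//= sumEFin lte_fin => sA.
exists (fset_set A) => // B /fsubsetP AB.
rewrite partial_sumE -rmorph_sum -rmorphB normc_def /= expr0n /= addr0.
rewrite sqrtr_sqr ltcR.
have gB : \sum_(k <- B) g k <= fine s.
  rewrite -lee_fin sE -sumEFin; apply: esum_ge; exists [set` B] => //.
  by rewrite fsbig_finite//= set_fsetK.
rewrite ger0_norm ?subr_ge0// ltrBlDr -ltrBlDl (lt_le_trans sA)//.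
rewrite [leRHS](big_fsetID _ (mem A))/=.
rewrite (_ : [fset x | x in B & x \in A]%fset = fset_set A); last first.
  apply/fsetP => x; rewrite !inE/= in_fset_set//.
  by apply/andP/idP => [[]//|xA]; split=> //; apply: AB; rewrite in_fset_set.
by rewrite lerDl sumr_ge0.
Qed.

(* Split into positive and negative, real and imaginary parts. *)
Lemma has_sum_summable K (f : K -> R[i]) (g : K -> R) :
  (forall k, `|f k| <= (g k)%:C) ->
  (\esum_(k in [set: K]) (g k)%:E < +oo)%E ->
  has_sum (f : K -> R[i]^o) (sum (f : K -> R[i]^o)).
Proof.
move=> fg goo.
have cv (h : K -> R) : (forall k, 0 <= h k <= g k) ->
    exists l, has_sum (fun k => (h k)%:C : R[i]^o) l.
  move=> hg; eexists; apply: has_sum_ge0 => [k|]; first by have /andP[] := hg k.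
  apply: le_lt_trans goo; apply: le_esum => k _; rewrite lee_fin.
  by have /andP[] := hg k.
have Reg k : `|complex.Re (f k)| <= g k.
  rewrite -lecR; apply: le_trans (fg k); rewrite normc_def lecR -sqrtr_sqr.
  by rewrite ler_wsqrtr// lerDl sqr_ge0.
have Img k : `|complex.Im (f k)| <= g k.
  rewrite -lecR; apply: le_trans (fg k); rewrite normc_def lecR -sqrtr_sqr.
  by rewrite ler_wsqrtr// lerDr sqr_ge0.
have part (h : K -> R) : (forall k, `|h k| <= g k) ->
    exists l, has_sum (fun k => (h k)%:C : R[i]^o) l.
  move=> hg.
  have [k|l hl] := cv (fun k => Num.max (h k) 0).
    rewrite le_max lexx orbT ge_max (le_trans (ler_norm _) (hg k)).
    by rewrite (le_trans _ (hg k)).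
  have [k|m hm] := cv (fun k => Num.max (- h k) 0).
    rewrite le_max lexx orbT ge_max (le_trans _ (hg k))//=.
      by rewrite (le_trans _ (hg k)).
    by rewrite -normrN ler_norm.
  exists (l + -1 *: m); have := has_sumD hl (has_sumZ (c := -1) hm).
  congr (has_sum _ _); apply/funext => k.
  rewrite scaleN1r -[LHS]/((_ : R[i]) - _) -rmorphB; congr (_%:C).
  by have [h0|h0] := leP (h k) 0; [rewrite max_l ?oppr_ge0// sub0r opprK|
    rewrite max_r ?subr0// oppr_le0 ltW].
have [l hl] := part _ Reg; have [m hm] := part _ Img.
have : has_sum (f : K -> R[i]^o) (l + 'i%C *: m).
  have := has_sumD hl (has_sumZ (c := 'i%C) hm).
  by congr (has_sum _ _); apply/funext => k; rewrite [RHS]complexE.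
by move=> fl; rewrite (has_sum_sum fl).
Qed.

(** Off the range of [h] the terms vanish, so the partial sum of [f] over [B] is that of [f \o h]
    over the preimage [phi B]. The two families of partial sums then define the same filter, hence
    the same [lim]. *)
Lemma sum_inj J K (h : J -> K) (f : K -> R[i]) : injective h ->
  (forall k, ~ range h k -> f k = 0) ->
  sum (f : K -> R[i]^o) = sum (f \o h : J -> R[i]^o).
Proof.
move=> hI f0.
have finh (B : {fset K}) : finite_set (h @^-1` [set` B]).
  by apply: finite_preimage => // x y _ _; exact: hI.
pose phi (B : {fset K}) := fset_set (h @^-1` [set` B]).
have phiE (B : {fset K}) j : (j \in phi B) = (h j \in B).
  by rewrite in_fset_set//; apply/idP/idP; rewrite inE.
have pE (B : {fset K}) : partial_sum (f : K -> R[i]^o) B =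
    partial_sum (f \o h : J -> R[i]^o) (phi B).
  rewrite !partial_sumE (big_fsetID _ (mem (range h)))/= [X in _ + X]big1_fset.
    rewrite addr0 (_ : [fset x | x in B & x \in range h]%fset =
        [fset h j | j in phi B]%fset).
      by rewrite big_imfset//= => x y _ _; exact: hI.
    apply/fsetP => k; rewrite !inE/=; apply/andP/imfsetP => /=.
      move=> [kB]; rewrite inE => -[j _ jk]; exists j => //=.
      by rewrite phiE jk.
    by move=> [j /=]; rewrite phiE => hB ->; split=> //; rewrite inE; exists j.
  move=> k; rewrite !inE/= => /andP[_ /negP kh] _; apply: f0 => kh'; apply: kh.
  by rewrite inE.
rewrite /sum; congr (lim _); apply/seteqP; split=> P /=.
  (* A finite [B] containing [phi A] is the preimage of [A] enlarged by the image of [B]. *)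
  move=> [A _ AP]; exists (phi A) => // B AB.
  have := AP (A `|` [fset h j | j in B])%fset (fsubsetUl _ _).
  rewrite /= pE (_ : phi _ = B)//; apply/fsetP => j; rewrite phiE inE.
  apply/orP/idP => [[|/imfsetP[j' /= j'B /hI->//]]|jB].
    by rewrite -phiE; apply: (fsubsetP AB).
  by right; apply/imfsetP; exists j.
move=> [A _ AP]; exists [fset h j | j in A]%fset => // B AB.
rewrite /= pE; apply: AP; apply/fsubsetP => j jA; rewrite phiE.
by apply: (fsubsetP AB); apply/imfsetP; exists j.
Qed.

(** After reindexing by [h], the partial sums are constant as soon as they run over all of [F]. *)
Lemma sum_fin (F : finType) K (h : F -> K) (f : K -> R[i]) : injective h ->
  (forall k, ~ range h k -> f k = 0) ->
  sum (f : K -> R[i]^o) = \sum_(a : F) f (h a).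
Proof.
move=> hI f0; rewrite (sum_inj hI f0); apply: has_sum_sum.
apply: cvg_near_cst; exists [fset a in {: F}]%fset => // B AB.
rewrite /= partial_sumE -big_enum; apply: perm_big.
rewrite uniq_perm ?enum_uniq ?fset_uniq// => a; rewrite mem_enum.
by apply: (fsubsetP AB); rewrite inE.
Qed.

End UnorderedSum.

(** * Square-summable families and bounded operators *)

Section Ell2.
Variables (R : realType) (K : choiceType).
Implicit Types (u v w : K -> R[i]) (X Y : op R K).

(** The squared modulus as an element of [R], in the form summed by [sqnorm]; the norm of [R[i]]
    takes its values in [R[i]]. *)
Definition abs2 (z : R[i]) : R := complex.Re z ^+ 2 + complex.Im z ^+ 2.

Lemma abs2_ge0 z : 0 <= abs2 z.
Proof. by rewrite addr_ge0// sqr_ge0. Qed.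

Lemma abs2M x y : abs2 (x * y) = abs2 x * abs2 y.
Proof. by case: x y => a b [c d]; rewrite /abs2 /=; ring. Qed.

Lemma abs2J x : abs2 x^* = abs2 x.
Proof. by case: x => a b; rewrite /abs2 /= sqrrN. Qed.

(** By the parallelogram law the right side exceeds the left by [abs2 (x - y)]. *)
Lemma abs2D x y : abs2 (x + y) <= 2 * abs2 x + 2 * abs2 y.
Proof.
case: x y => a b [c d]; rewrite /abs2 /=.
have := sqr_ge0 (a - c); have := sqr_ge0 (b - d); nra.
Qed.

Lemma norm_conjM x y : `|x^* * y| <= (abs2 x + abs2 y)%:C.
Proof.
rewrite normrM norm_conjC rmorphD /= !add_Re2_Im2 !normc_def.
set a := Num.sqrt _; set b := Num.sqrt _.
rewrite -!rmorphXn -rmorphM -rmorphD lecR.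
by have := sqr_ge0 (a - b); have := sqr_ge0 (a + b); nra.
Qed.

Lemma esumZ_le (c : R) (f : K -> R) : 0 <= c -> (forall k, 0 <= f k) ->
  (\esum_(k in [set: K]) (c * f k)%:E <=
   c%:E * \esum_(k in [set: K]) (f k)%:E)%E.
Proof.
move=> c0 f0; apply: ge_ereal_sup => _ [A [finA _] <-].
rewrite fsbig_finite//= sumEFin -mulr_sumr EFinM lee_wpmul2l// -sumEFin.
by apply: esum_ge; exists A => //; rewrite fsbig_finite.
Qed.

Lemma sqnorm_ge0 v : (0 <= sqnorm v)%E.
Proof. by apply: esum_ge0 => k _; rewrite lee_fin abs2_ge0. Qed.

Lemma sqnormE v : ell2 v -> sqnorm v = (fine (sqnorm v))%:E.
Proof. by move=> v2; rewrite fineK// ge0_fin_numE// sqnorm_ge0. Qed.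

Lemma abs2_le_sqnorm v k : ((abs2 (v k))%:E <= sqnorm v)%E.
Proof.
apply: esum_ge; exists [set k]; first by split.
by rewrite fsbig_set1.
Qed.

Lemma sqnormZ_le (a : R[i]) v :
  (sqnorm (fun k => a * v k)%R <= (abs2 a)%:E * sqnorm v)%E.
Proof.
apply: le_trans (esumZ_le (abs2_ge0 a) (fun k => abs2_ge0 (v k))).
by apply: le_esum => k _; rewrite lee_fin -/(abs2 _) abs2M.
Qed.

Lemma sqnormD_le u v :
  (sqnorm (fun k => u k + v k)%R <= 2%:E * sqnorm u + 2%:E * sqnorm v)%E.
Proof.
apply: (@le_trans _ _ (\esum_(k in [set: K])
  ((2 * abs2 (u k))%:E + (2 * abs2 (v k))%:E))%E).
  by apply: le_esum => k _; rewrite -EFinD lee_fin -/(abs2 _) abs2D.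
rewrite esumD; first by rewrite leeD// esumZ_le// => k; exact: abs2_ge0.
  by move=> k _; rewrite lee_fin mulr_ge0// abs2_ge0.
by move=> k _; rewrite lee_fin mulr_ge0// abs2_ge0.
Qed.

Lemma ell2Z (a : R[i]) v : ell2 v -> ell2 (fun k => a * v k).
Proof.
move=> v2; apply: le_lt_trans (sqnormZ_le a v) _.
by rewrite (sqnormE v2) -EFinM ltry.
Qed.

Lemma ell2D u v : ell2 u -> ell2 v -> ell2 (fun k => u k + v k).
Proof.
move=> u2 v2; apply: le_lt_trans (sqnormD_le u v) _.
by rewrite (sqnormE u2) (sqnormE v2) -!EFinM -EFinD ltry.
Qed.

Lemma ell2ZD (a : R[i]) u v :
  ell2 u -> ell2 v -> ell2 (fun k => a * u k + v k).
Proof. by move=> u2 v2; apply: ell2D => //; exact: ell2Z. Qed.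

Lemma ell2_0 : ell2 (fun _ : K => 0 : R[i]).
Proof.
by rewrite /ell2 /= /sqnorm esum1 ?ltry// => k _ /=; rewrite expr0n addr0.
Qed.

Lemma ell2_sum (F : finType) (w : F -> K -> R[i]) :
  (forall a, ell2 (w a)) -> ell2 (fun k => \sum_a w a k).
Proof.
move=> w2; elim: (index_enum F) => [|a s IH].
  by under [X in ell2 X]eq_fun do rewrite big_nil; exact: ell2_0.
by under [X in ell2 X]eq_fun do rewrite big_cons; exact: ell2D.
Qed.

Lemma ell2J v : ell2 v -> ell2 (fun k => (v k)^*).
Proof.
rewrite /ell2 /= /sqnorm; apply: le_lt_trans; apply: le_esum => k _.
by rewrite lee_fin -/(abs2 _) abs2J.
Qed.

Lemma sqnorm_ket (k : K) : sqnorm (ket R k) = 1%E.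
Proof.
rewrite /sqnorm (esumID [set k])//; last first.
  by move=> m _; rewrite lee_fin abs2_ge0.
rewrite setTI setTI esum_set1 ?lee_fin ?abs2_ge0//.
rewrite esum1 ?adde0 /ket ?eqxx /= ?expr1n ?expr0n /= ?addr0// => m /= mk.
by case: eqP => [//|_] /=; rewrite expr0n addr0.
Qed.

Lemma ell2_ket (k : K) : ell2 (ket R k).
Proof. by rewrite /ell2 /= sqnorm_ket ltry. Qed.

(** * The inner product of square-summable families *)

Lemma inner_has_sum u v : ell2 u -> ell2 v ->
  has_sum (fun k => (u k)^* * v k : R[i]^o) (inner u v).
Proof.
move=> u2 v2.
(* The crude bound [norm_conjM] dominates the terms by a summable family. *)
apply: (@has_sum_summable _ _ _ (fun k => abs2 (u k) + abs2 (v k))).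
  by move=> k; exact: norm_conjM.
under eq_esum do rewrite EFinD.
rewrite esumD; try by move=> k _; rewrite lee_fin abs2_ge0.
exact: lte_add_pinfty.
Qed.

Lemma innerZD (a : R[i]) u v w : ell2 u -> ell2 v -> ell2 w ->
  inner u (fun k => a * v k + w k) = a * inner u v + inner u w.
Proof.
move=> u2 v2 w2; apply: (@has_sum_sum _ R[i]^o).
have := has_sumD (has_sumZ (c := a) (inner_has_sum u2 v2))
  (inner_has_sum u2 w2).
congr (has_sum _ _); apply/funext => k.
by rewrite -[a *: _]/(a * _); rewrite mulrDr mulrCA.
Qed.

Lemma innerJJ u v : ell2 u -> ell2 v ->
  inner (fun k => (u k)^*) (fun k => (v k)^*) = (inner u v)^*.
Proof.
move=> u2 v2; apply: (@has_sum_sum _ R[i]^o).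
have := has_sumJ (inner_has_sum u2 v2).
by congr (has_sum _ _); apply/funext => k; rewrite rmorphM.
Qed.

Lemma inner_sym u v : ell2 u -> ell2 v -> inner v u = (inner u v)^*.
Proof.
move=> u2 v2; apply: (@has_sum_sum _ R[i]^o).
have := has_sumJ (inner_has_sum u2 v2).
by congr (has_sum _ _); apply/funext => k; rewrite rmorphM /= conjCK mulrC.
Qed.

Lemma inner0 u : inner u (fun _ => 0) = 0.
Proof.
(* All terms vanish, so the support lies in the image of the empty type. *)
rewrite /inner (@sum_fin _ void _ (fun x => match x with end))//.
  by rewrite big1 // => -[].
by move=> k _; rewrite mulr0.
Qed.

Lemma innerD u v w : ell2 u -> ell2 v -> ell2 w ->
  inner u (fun k => v k + w k) = inner u v + inner u w.
Proof.
move=> u2 v2 w2; rewrite -[X in X + _]mul1r -innerZD//.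
by congr inner; apply/funext => k; rewrite mul1r.
Qed.

Lemma innerZ (a : R[i]) u v : ell2 u -> ell2 v ->
  inner u (fun k => a * v k) = a * inner u v.
Proof.
move=> u2 v2; rewrite -[RHS]addr0 -(inner0 u) -innerZD//; last exact: ell2_0.
by congr inner; apply/funext => k; rewrite addr0.
Qed.

Lemma inner_sum (F : finType) u (w : F -> K -> R[i]) :
  ell2 u -> (forall a, ell2 (w a)) ->
  inner u (fun k => \sum_a w a k) = \sum_a inner u (w a).
Proof.
move=> u2 w2.
(* The induction over lists also carries square-summability, which [innerD] requires of the tail. *)
have : forall s : seq F, ell2 (fun k => \sum_(a <- s) w a k) /\
    inner u (fun k => \sum_(a <- s) w a k) = \sum_(a <- s) inner u (w a).
  elim=> [|a s [IH1 IH2]].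
    under [X in ell2 X]eq_fun do rewrite big_nil.
    under [X in inner u X]eq_fun do rewrite big_nil.
    by rewrite big_nil inner0; split=> //; exact: ell2_0.
  under [X in ell2 X]eq_fun do rewrite big_cons.
  under [X in inner u X]eq_fun do rewrite big_cons.
  by rewrite big_cons -IH2 innerD//; split=> //; exact: ell2D.
by move=> /(_ (index_enum F))[].
Qed.

Lemma innerDl u v w : ell2 u -> ell2 v -> ell2 w ->
  inner (fun k => u k + v k) w = inner u w + inner v w.
Proof.
move=> u2 v2 w2; rewrite inner_sym ?innerD ?rmorphD//=; last exact: ell2D.
by rewrite -!inner_sym.
Qed.

Lemma innerZl (a : R[i]) u v : ell2 u -> ell2 v ->
  inner (fun k => a * u k) v = a^* * inner u v.
Proof.
move=> u2 v2; rewrite inner_sym ?innerZ ?rmorphM//=; last exact: ell2Z.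
by rewrite -inner_sym.
Qed.

Lemma inner_ket k v : inner (ket R k) v = v k.
Proof.
rewrite /inner (@sum_fin _ unit _ (fun=> k)).
- by rewrite big_const card_unit /= addr0 /ket eqxx rmorph1 mul1r.
- by move=> [] [].
- move=> m mk; rewrite /ket; case: eqP => [mk'|_].
    by case: mk; exists tt.
  by rewrite rmorph0 mul0r.
Qed.

Lemma inner_ketr k v : inner v (ket R k) = (v k)^*.
Proof.
rewrite /inner (@sum_fin _ unit _ (fun=> k)).
- by rewrite big_const card_unit /= addr0 /ket eqxx /= mulr1.
- by move=> [] [].
- move=> m mk; rewrite /ket; case: eqP => [mk'|_]; last by rewrite mulr0.
  by case: mk; exists tt.
Qed.

(** * Bounded and positive operators *)

Lemma bounded_linear_ge0 X : bounded_linear X -> exists2 c : R, 0 <= c &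
  forall v, ell2 v -> (sqnorm (X v) <= c%:E * sqnorm v)%E.
Proof.
(* The given constant may be negative, and inequalities in [\bar R] can only be multiplied by a
   nonnegative one. *)
move=> [_ [c cX]]; exists `|c| => // v v2; apply: le_trans (cX v v2) _.
by rewrite lee_wpmul2r ?sqnorm_ge0// lee_fin ler_norm.
Qed.

Lemma bounded_linear_ell2 X v : bounded_linear X -> ell2 v -> ell2 (X v).
Proof.
move=> [_ [c cX]] v2; apply: le_lt_trans (cX v v2) _.
by rewrite (sqnormE v2) -EFinM ltry.
Qed.

Lemma bounded_linearZD X (a : R[i]) u v :
  bounded_linear X -> ell2 u -> ell2 v ->
  X (fun k => a * u k + v k) = (fun k => a * X u k + X v k).
Proof. by move=> [lX _] u2 v2; exact: lX. Qed.

Lemma bounded_linear0 X : bounded_linear X -> X (fun _ => 0) = (fun _ => 0).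
Proof.
move=> bX; have := bounded_linearZD (-1) bX ell2_0 ell2_0.
have -> : (fun _ : K => -1 * 0 + 0 : R[i]) = fun _ => 0.
  by apply/funext => k; rewrite mulr0 addr0.
by move=> ->; apply/funext => k; rewrite mulN1r addNr.
Qed.

Lemma bounded_linear_lincomb (F : finType) X (c : F -> R[i])
    (w : F -> K -> R[i]) :
  bounded_linear X -> (forall a, ell2 (w a)) ->
  X (fun k => \sum_a c a * w a k) = (fun k => \sum_a c a * X (w a) k).
Proof.
move=> bX w2.
have : forall s : seq F, ell2 (fun k => \sum_(a <- s) c a * w a k) /\
    X (fun k => \sum_(a <- s) c a * w a k) =
    (fun k => \sum_(a <- s) c a * X (w a) k).
  elim=> [|a s [IH1 IH2]].
    have -> : (fun k => \sum_(a <- [::]) c a * w a k) = fun _ => 0.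
      by apply/funext => k; rewrite big_nil.
    split; first exact: ell2_0.
    by rewrite bounded_linear0//; apply/funext => k; rewrite big_nil.
  have -> : (fun k => \sum_(b <- a :: s) c b * w b k) =
      fun k => c a * w a k + \sum_(b <- s) c b * w b k.
    by apply/funext => k; rewrite big_cons.
  split; first exact: ell2ZD.
  rewrite bounded_linearZD// IH2.
  by apply/funext => k; rewrite big_cons.
by move=> /(_ (index_enum F))[].
Qed.

Lemma bounded_linear_comp X Y :
  bounded_linear X -> bounded_linear Y -> bounded_linear (fun v => X (Y v)).
Proof.
move=> bX bY; split=> [a u v u2 v2|].
  by rewrite !bounded_linearZD//; exact: bounded_linear_ell2.
have [c c0 cX] := bounded_linear_ge0 bX.
have [d d0 dY] := bounded_linear_ge0 bY.
exists (c * d) => v v2; apply: le_trans (cX _ (bounded_linear_ell2 bY v2)) _.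
by rewrite EFinM -muleA lee_wpmul2l// dY.
Qed.

Lemma bounded_linear_zero : bounded_linear (@op_zero R K).
Proof.
split=> [a u v _ _|]; first by apply/funext => k; rewrite mulr0 addr0.
exists 0 => v _; rewrite mul0e /sqnorm esum1// => k _ /=.
by rewrite expr0n addr0.
Qed.

Lemma bounded_linearZ (a : R[i]) X :
  bounded_linear X -> bounded_linear (fun v k => a * X v k).
Proof.
move=> bX; split=> [b u v u2 v2|].
  by rewrite bounded_linearZD//; apply/funext => k; rewrite mulrDr mulrCA.
have [c c0 cX] := bounded_linear_ge0 bX.
exists (abs2 a * c) => v v2; apply: le_trans (sqnormZ_le _ _) _.
by rewrite EFinM -muleA lee_wpmul2l ?lee_fin ?abs2_ge0// cX.
Qed.

Lemma bounded_linearD X Y : bounded_linear X -> bounded_linear Y ->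
  bounded_linear (fun v k => X v k + Y v k).
Proof.
move=> bX bY; split=> [a u v u2 v2|].
  by rewrite !bounded_linearZD//; apply/funext => k; rewrite mulrDr addrACA.
have [c c0 cX] := bounded_linear_ge0 bX.
have [d d0 dY] := bounded_linear_ge0 bY.
exists (2 * c + 2 * d) => v v2; apply: le_trans (sqnormD_le _ _) _.
have c20 : (0 <= (2 * c)%:E)%E by rewrite lee_fin mulr_ge0.
have d20 : (0 <= (2 * d)%:E)%E by rewrite lee_fin mulr_ge0.
rewrite (EFinD (2 * c)) ge0_muleDl// !EFinM -!muleA leeD//.
  by rewrite lee_wpmul2l ?lee_fin// cX.
by rewrite lee_wpmul2l ?lee_fin// dY.
Qed.

Lemma bounded_linear_sum (F : finType) (X : F -> op R K) :
  (forall a, bounded_linear (X a)) ->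
  bounded_linear (fun v k => \sum_a X a v k).
Proof.
move=> bX; elim: (index_enum F) => [|a s IH].
  rewrite (_ : (fun _ => _) = @op_zero R K); first exact: bounded_linear_zero.
  by apply/funext => v; apply/funext => k; rewrite big_nil.
rewrite (_ : (fun _ => _) = fun v k => X a v k + \sum_(b <- s) X b v k).
  exact: bounded_linearD.
by apply/funext => v; apply/funext => k; rewrite big_cons.
Qed.

Lemma bounded_linear_ketbra k l : bounded_linear (@ketbra R K k l).
Proof.
split=> [a u v _ _|]; first by apply/funext => m; rewrite /ketbra mulrDl mulrA.
exists 1 => v v2; rewrite mul1e; apply: le_trans (abs2_le_sqnorm v l).
by apply: le_trans (sqnormZ_le _ _) _; rewrite sqnorm_ket mule1.
Qed.

(** Sesquilinear expansion of the form of [X]. It serves the polarisation below, with [c] equal to 1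
    and to the imaginary unit, and the later positivity tests, with [c] a sign. *)
Lemma innerZD_form X (c : R[i]) u v : bounded_linear X -> ell2 u -> ell2 v ->
  inner (fun k => c * u k + v k) (X (fun k => c * u k + v k)) =
  c^* * c * inner u (X u) + c^* * inner u (X v) + c * inner v (X u) +
  inner v (X v).
Proof.
move=> bX u2 v2; have Xu := bounded_linear_ell2 bX u2.
have Xv := bounded_linear_ell2 bX v2.
rewrite bounded_linearZD// innerDl//; [|exact: ell2Z|exact: ell2ZD].
rewrite innerZl//; last exact: ell2ZD.
by rewrite !innerZD// mulrDr mulrA addrA.
Qed.

Lemma positive_inner_ge0 X v : positive X -> ell2 v -> 0 <= inner v (X v).
Proof.
move=> [_ X0] v2; have := X0 v v2; congr (0 <= inner v _).
by apply/funext => k; rewrite /op_zero subr0.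
Qed.

(* Polarisation: the form is real at u + v and at 'i u + v. *)
Lemma positive_self_adjoint X u v : positive X -> ell2 u -> ell2 v ->
  inner (X u) v = inner u (X v).
Proof.
move=> pX u2 v2; have [bX _] := pX.
have real w : ell2 w -> complex.Im (inner w (X w)) = 0.
  by move=> w2; apply: ger0_Im; exact: positive_inner_ge0.
rewrite inner_sym//; last exact: bounded_linear_ell2.
have := real _ (ell2ZD 1 u2 v2); have := real _ (ell2ZD 'i%C u2 v2).
rewrite !innerZD_form//.
have := real u u2; have := real v v2.
case: (inner u (X u)) => a b; case: (inner v (X v)) => c d.
case: (inner u (X v)) => x y; case: (inner v (X u)) => z t /=.
move=> -> ->; rewrite !(mul0r, mul1r, mulr0, mulr1, addr0, add0r, subr0, oppr0).
move=> h1 h2; congr (_ +i* _); lra.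
Qed.

End Ell2.

Lemma ell2_slice (R : realType) (I J : choiceType) (v : I * J -> R[i]) (i : I) :
  ell2 v -> ell2 (fun j => v (i, j)).
Proof.
apply: le_lt_trans; rewrite /sqnorm.
rewrite -(@esum_image _ _ _ setT (fun j => (i, j)) (fun k => (abs2 (v k))%:E)).
  rewrite esum_mkcond; apply: le_esum => k _.
  by case: ifP => // _; rewrite lee_fin abs2_ge0.
by move=> j l _ _ [].
Qed.

(** * Marginal and partial transpose over a finite tensor factor *)

(* K is the product of F with another index set, coord k is the F-component of
   k, and sub k a replaces this component by a. *)
Definition tensor_factor (K : choiceType) (F : finType) (coord : K -> F)
    (sub : K -> F -> K) : Prop :=
  [/\ forall k a, coord (sub k a) = a,
      forall k a b, sub (sub k a) b = sub k b &
      forall k, sub k (coord k) = k].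

Lemma esum_finType (R : realType) (F : finType) (f : F -> \bar R) :
  (forall a, (0 <= f a)%E) -> \esum_(a in [set: F]) f a = (\sum_a f a)%E.
Proof.
have finF : finite_set [set: F] by exact: finite_finset.
move=> f0; rewrite esum_fset// fsbig_finite//= -big_enum; apply: perm_big.
rewrite uniq_perm ?enum_uniq ?fset_uniq// => a.
by rewrite mem_enum in_fset_set//; exact: mem_set.
Qed.

Section TensorFactor.
Variables (R : realType) (K : choiceType) (F : finType).
Variables (coord : K -> F) (sub : K -> F -> K).
Hypothesis factorF : tensor_factor coord sub.
Implicit Types (v w : K -> R[i]) (X rho : op R K).

Let coord_sub k a : coord (sub k a) = a. Proof. by case: factorF. Qed.
Let sub_sub k a b : sub (sub k a) b = sub k b. Proof. by case: factorF. Qed.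
Let sub_coord k : sub k (coord k) = k. Proof. by case: factorF. Qed.

(* The operator |a><b| on the factor F, tensored with the identity. *)
Definition munit (a b : F) : op R K :=
  fun v k => v (sub k b) * (coord k == a)%:R.

(** The permutation of the basis that exchanges the [F]-components [a] and [b]. Up to it,
    [munit a b] is multiplication by an indicator, so reindexing along it gives both the adjoint and
    the norm bound of [munit a b]. *)
Definition swap (a b : F) (k : K) : K :=
  if coord k == a then sub k b else if coord k == b then sub k a else k.

Lemma swapK a b : involutive (swap a b).
Proof.
move=> k; rewrite /swap.
case: (eqVneq (coord k) a) => [<-|ka].
  rewrite !coord_sub !sub_sub eqxx sub_coord.
  by case: eqP => [->|]; rewrite ?sub_coord.
case: (eqVneq (coord k) b) => [<-|kb].
  by rewrite !coord_sub eqxx sub_sub sub_coord.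
by rewrite (negPf ka) (negPf kb).
Qed.

Lemma munit_swap a b v k : munit a b v (swap a b k) = v k * (coord k == b)%:R.
Proof.
rewrite /munit /swap.
case: (eqVneq (coord k) a) => [<-|ka].
  rewrite coord_sub sub_sub [b == _]eq_sym; case: eqP => [<-|_].
    by rewrite sub_coord.
  by rewrite !mulr0.
case: (eqVneq (coord k) b) => [<-|kb]; last by rewrite (negPf ka) !mulr0.
by rewrite coord_sub sub_sub eqxx sub_coord.
Qed.

Lemma munit_adjoint a b v w : inner (munit a b v) w = inner v (munit b a w).
Proof.
rewrite /inner (sum_inj (h := swap a b)); last 2 first.
- exact: inv_inj (@swapK a b).
- by move=> k kr; exfalso; apply: kr; exists (swap a b k); rewrite ?swapK.
congr (@sum K _ R[i]^o _); apply/funext => k /=.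
rewrite munit_swap rmorphM /= -mulrA.
congr (_ * _); rewrite /munit /swap.
case: (eqVneq (coord k) b) => [kb|_]; last by rewrite rmorph0 mul0r mulr0.
rewrite rmorph1 mul1r mulr1; case: eqP => // ka.
by rewrite -kb ka.
Qed.

Lemma munit_bounded a b : bounded_linear (munit a b).
Proof.
split=> [c u v _ _|]; first by apply/funext => k; rewrite /munit mulrDl mulrA.
exists 1 => v v2; rewrite mul1e /sqnorm.
rewrite (reindex_esum [set: K] _ (swap a b)); last first.
  split => // [x y _ _|k _]; first exact: (inv_inj (@swapK a b)).
  by exists (swap a b k); rewrite ?swapK.
apply: le_esum => k _; rewrite lee_fin -/(abs2 _) -/(abs2 _) munit_swap abs2M.
case: eqP => _; rewrite /abs2 /= expr0n ?expr1n /= addr0 ?mulr1// mulr0.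
exact: abs2_ge0.
Qed.

Lemma munit_ell2 a b v : ell2 v -> ell2 (munit a b v).
Proof. exact: bounded_linear_ell2 (munit_bounded a b). Qed.

Lemma munit_munit a b c d v :
  munit a b (munit c d v) = fun k => (b == c)%:R * munit a d v k.
Proof.
apply/funext => k; rewrite /munit coord_sub sub_sub.
by case: (b == c); rewrite ?mulr1 ?mul1r// mulr0 !mul0r.
Qed.

(* The partial trace over F, tensored with the identity of F. *)
Definition factor_marginal X : op R K :=
  fun v k => \sum_a \sum_b munit b a (X (munit a b v)) k.

(** Differs from [factor_marginal] only in the outer matrix unit; this common shape makes the two
    operators comparable term by term. *)
Definition factor_transpose X : op R K :=
  fun v k => \sum_a \sum_b munit a b (X (munit a b v)) k.

(** The outer unit [munit b a] has output supported on the [F]-component [b], so only [b = coord k]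
    contributes at [k]. *)
Lemma factor_marginalE X v k :
  factor_marginal X v k = \sum_a X (munit a (coord k) v) (sub k a).
Proof.
apply: eq_bigr => a _; rewrite (bigD1 (coord k))//= big1 ?addr0.
  by rewrite {1}/munit eqxx mulr1.
by move=> b kb; rewrite /munit eq_sym (negPf kb) mulr0.
Qed.

Lemma factor_transposeE X v k :
  factor_transpose X v k = \sum_b X (munit (coord k) b v) (sub k b).
Proof.
rewrite /factor_transpose (bigD1 (coord k))//= [X in _ + X]big1 ?addr0.
  by apply: eq_bigr => b _; rewrite {1}/munit eqxx mulr1.
move=> a ka; rewrite big1// => b _.
by rewrite /munit eq_sym (negPf ka) mulr0.
Qed.

Lemma factor_marginal_bounded X :
  bounded_linear X -> bounded_linear (factor_marginal X).
Proof.
move=> bX; apply: bounded_linear_sum => a; apply: bounded_linear_sum => b.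
apply: (@bounded_linear_comp _ _ (munit b a) (fun v => X (munit a b v))).
  exact: munit_bounded.
by apply: (bounded_linear_comp bX); exact: munit_bounded.
Qed.

Lemma factor_transpose_bounded X :
  bounded_linear X -> bounded_linear (factor_transpose X).
Proof.
move=> bX; apply: bounded_linear_sum => a; apply: bounded_linear_sum => b.
apply: (@bounded_linear_comp _ _ (munit a b) (fun v => X (munit a b v))).
  exact: munit_bounded.
by apply: (bounded_linear_comp bX); exact: munit_bounded.
Qed.

(** The functions [c] and [d] select the outer matrix unit, so that one computation covers the
    marginal and the transpose. *)
Lemma inner_munit_sum X v (c d : F -> F -> F) : bounded_linear X -> ell2 v ->
  inner v (fun k => \sum_a \sum_b munit (c a b) (d a b) (X (munit a b v)) k) =
  \sum_a \sum_b inner (munit (d a b) (c a b) v) (X (munit a b v)).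
Proof.
move=> bX v2.
have M2 a b e f : ell2 (munit e f (X (munit a b v))).
  exact: munit_ell2 (bounded_linear_ell2 bX (munit_ell2 _ _ v2)).
rewrite inner_sum//; last by move=> a; apply: ell2_sum => b.
apply: eq_bigr => a _; rewrite inner_sum//; apply: eq_bigr => b _.
by rewrite munit_adjoint.
Qed.

(** The adjoint of the outer unit [munit b a] is the inner one, so the form at [v] is the sum of the
    values of the form of [X] at the vectors [munit a b v]. *)
Lemma factor_marginal_positive X : positive X -> positive (factor_marginal X).
Proof.
move=> pX; have [bX _] := pX; split; first exact: factor_marginal_bounded.
move=> v v2; rewrite (_ : (fun k => _) = factor_marginal X v); last first.
  by apply/funext => k; rewrite subr0.
rewrite (inner_munit_sum (fun _ b => b) (fun a _ => a))//.
apply: sumr_ge0 => a _; apply: sumr_ge0 => b _; apply: positive_inner_ge0 => //.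
exact: munit_ell2.
Qed.

(* With u a b := munit a b v, the form is half the sum over a and b of the
   values of X at u a b + s * u b a. *)
Lemma factor_marginal_transpose_ge0 X v (s : R[i]) : positive X -> ell2 v ->
  s^* = s -> s * s = 1 ->
  0 <= inner v (fun k => factor_marginal X v k + s * factor_transpose X v k).
Proof.
move=> pX v2 sJ ss; have [bX _] := pX.
have Mb := bounded_linear_ell2 (factor_marginal_bounded bX) v2.
have Tb := bounded_linear_ell2 (factor_transpose_bounded bX) v2.
have u2 a b : ell2 (munit a b v) by exact: munit_ell2.
rewrite innerD//; last exact: ell2Z.
rewrite innerZ// (inner_munit_sum (fun _ b => b) (fun a _ => a))//.
rewrite (inner_munit_sum (fun a _ => a) (fun _ b => b))//.
pose g a b := inner (munit a b v) (X (munit a b v)).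
pose h a b := inner (munit b a v) (X (munit a b v)).
pose q a b := inner (fun k => s * munit b a v k + munit a b v k)
  (X (fun k => s * munit b a v k + munit a b v k)).
have qE a b : q a b = g b a + s * h a b + s * h b a + g a b.
  by rewrite /q innerZD_form// sJ ss mul1r.
have q0 : 0 <= \sum_a \sum_b q a b.
  apply: sumr_ge0 => a _; apply: sumr_ge0 => b _.
  by apply: positive_inner_ge0 => //; exact: ell2ZD.
have : \sum_a \sum_b q a b =
    2 * (\sum_a \sum_b g a b + s * \sum_a \sum_b h a b).
  under eq_bigr do under eq_bigr do rewrite qE.
  under eq_bigr do rewrite !big_split /= -!mulr_sumr.
  (* Exchanging the names of [a] and [b] identifies the terms in pairs, whence the factor 2. *)
  rewrite !big_split /= -!mulr_sumr [\sum_i \sum_j g j i]exchange_big.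
  by rewrite [\sum_i \sum_j h j i]exchange_big /=; ring.
by move=> qT; move: q0; rewrite qT pmulr_rge0// ltr0n.
Qed.

(** The marginal acts as the identity on [F], and the identity is its own transpose: by
    orthogonality of matrix units only the term [b = coord k] survives. *)
Lemma factor_transpose_marginal X : bounded_linear X ->
  factor_transpose (factor_marginal X) = factor_marginal X.
Proof.
move=> bX; apply/funext => v; apply/funext => k.
rewrite factor_transposeE factor_marginalE (bigD1 (coord k))//= big1 ?addr0.
  rewrite factor_marginalE; apply: eq_bigr => a _.
  rewrite sub_sub coord_sub munit_munit eqxx.
  by congr X; apply/funext => m; rewrite mul1r.
move=> b kb; rewrite factor_marginalE big1// => a _.
rewrite coord_sub munit_munit (negPf kb).
rewrite (_ : (fun _ => _) = fun _ => 0) ?bounded_linear0//.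
by apply/funext => m; rewrite mul0r.
Qed.

Lemma munit_ket a k : munit a (coord k) (ket R k) = ket R (sub k a).
Proof.
apply/funext => m; rewrite /munit /ket -natrM mulnb.
congr (_%:R); congr nat_of_bool.
apply/andP/eqP => [[/eqP <- /eqP <-]|->].
  by rewrite sub_sub sub_coord.
by rewrite sub_sub sub_coord coord_sub !eqxx.
Qed.

Lemma factor_marginal_diag X k :
  factor_marginal X (ket R k) k = \sum_a X (ket R (sub k a)) (sub k a).
Proof.
by rewrite factor_marginalE; apply: eq_bigr => a _; rewrite munit_ket.
Qed.

(** [munit (coord k) b] annihilates [ket R k] unless [b = coord k], in which case it fixes it. *)
Lemma factor_transpose_diag X k : bounded_linear X ->
  factor_transpose X (ket R k) k = X (ket R k) k.
Proof.
move=> bX; rewrite factor_transposeE (bigD1 (coord k))//= big1 ?addr0.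
  by rewrite munit_ket sub_coord.
move=> b kb; rewrite (_ : munit _ _ _ = fun _ => 0) ?bounded_linear0//.
apply/funext => m; rewrite /munit /ket.
case: eqP => [mk|_]; last by rewrite mul0r.
by move: kb; rewrite -mk coord_sub eqxx.
Qed.

(* (k, a) |-> (sub k a, coord k) is an involution. *)
Lemma esum_sub (f : K -> \bar R) : (forall k, (0 <= f k)%E) ->
  \esum_(k in [set: K]) (\sum_a f (sub k a))%E =
  ((#|F|%:R)%:E * \esum_(k in [set: K]) f k)%E.
Proof.
move=> f0.
have s0 : (0 <= \esum_(k in [set: K]) f k)%E by exact: esum_ge0.
under eq_esum do rewrite -esum_finType//.
rewrite (@esum_esum _ _ _ setT (fun=> setT))//.
rewrite (reindex_esum ([set: K] `*`` (fun=> [set: F])) _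
  (fun p : K * F => (sub p.1 p.2, coord p.1))); last first.
  split=> //= [[k a] [l b] _ _ /= [kl kl']|[k a] _].
    have ab : a = b by rewrite -(coord_sub k a) kl coord_sub.
    congr (_, _) => //; rewrite -(sub_coord k) -(sub_coord l) -kl'.
    by rewrite -(sub_sub k a) kl sub_sub.
  by exists (sub k a, coord k) => //=; rewrite sub_sub sub_coord coord_sub.
under eq_esum do rewrite /= sub_sub sub_coord.
rewrite -(@esum_esum _ _ _ setT (fun=> setT) (fun k _ => f k))//.
under eq_esum do rewrite esum_finType//.
rewrite esum_sum//.
rewrite big_const; set s := esum _ _; elim: #|F| => [|n IH] /=.
  by rewrite mul0e.
by rewrite IH -natr1 EFinD ge0_muleDl ?lee_fin// mul1e addeC.
Qed.

(** Each diagonal entry of the marginal is a sum of diagonal entries of [X], and over all [k] every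
    entry of [X] is met once per element of [F]. *)
Lemma trace_factor_marginal X : positive X ->
  trace (factor_marginal X) = ((#|F|%:R)%:E * trace X)%E.
Proof.
move=> pX; rewrite /trace -esum_sub.
  apply: eq_esum => k _.
  rewrite inner_ket factor_marginal_diag raddf_sum -sumEFin.
  by apply: eq_bigr => a _; rewrite inner_ket.
move=> k; rewrite lee_fin.
by have := positive_inner_ge0 pX (ell2_ket R k); rewrite lecE => /andP[].
Qed.

End TensorFactor.

(** * The upper bound *)

Definition conj_if (R : realType) (c : bool) (z : R[i]) : R[i] :=
  if c then z^* else z.

(* c tells whether F indexes the first factor: the partial transpose on the
   second factor is then conjugate to the one on F. *)
Lemma kappa_le_factor (R : realType) (I J : choiceType) (F : finType)
    (coord : (I * J)%type -> F) (sub : (I * J)%type -> F -> (I * J)%type)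
    (c : bool) (rho : op R (I * J)%type) :
  tensor_factor coord sub ->
  (forall (X : op R (I * J)%type) v, positive X -> ell2 v ->
    ptranspose X v = fun p =>
      conj_if c (factor_transpose coord sub X (fun q => conj_if c (v q)) p)) ->
  state rho -> (kappa_entanglement rho <= log2 (#|F|%:R)%:E)%E.
Proof.
move=> factorF ptE [pos_rho tr_rho]; have [brho _] := pos_rho.
pose S := factor_marginal coord sub rho.
have pos_S : positive S by exact: factor_marginal_positive.
have trS : trace S = (#|F|%:R)%:E.
  by rewrite trace_factor_marginal// tr_rho mule1.
have TS : factor_transpose coord sub S = S by exact: factor_transpose_marginal.
rewrite -trS; apply: ereal_inf_lbound; exists S => //.
(* The values 1 and -1 of [s] give the two feasibility constraints. *)
have main (s : R[i]) v : ell2 v -> s^* = s -> s * s = 1 ->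
    0 <= inner v (fun p => ptranspose S v p + s * ptranspose rho v p).
  move=> v2 sJ ss; pose w q := conj_if c (v q).
  have w2 : ell2 w by rewrite /w /conj_if; case: (c) => //; exact: ell2J.
  pose u k := S w k + s * factor_transpose coord sub rho w k.
  have u2 : ell2 u.
    apply: ell2D; last apply: ell2Z; apply: bounded_linear_ell2 => //.
      by case: pos_S.
    exact: factor_transpose_bounded.
  have -> : (fun p => ptranspose S v p + s * ptranspose rho v p) =
      fun p => conj_if c (u p).
    apply/funext => p; rewrite !ptE// TS /u -/w /conj_if.
    by case: (c) => //; rewrite rmorphD rmorphM /= sJ.
  have -> : v = fun q => conj_if c (w q).
    (* When [c] holds, both arguments of the form are now conjugates; the form is the conjugate of
       [inner w u], and conjugation preserves nonnegativity. *)
    by apply/funext => q; rewrite /w /conj_if; case: (c); rewrite ?conjCK.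
  have : 0 <= inner w u by exact: factor_marginal_transpose_ge0.
  by rewrite /conj_if; case: (c) => //; rewrite innerJJ// conjC_ge0.
split; first by split=> //; rewrite trS ltry.
- move=> v v2; have := main 1 v v2 (rmorph1 _) (mulr1 _).
  congr (0 <= inner _ _); apply/funext => p.
  by rewrite /op_opp mul1r opprK addrC.
- move=> v v2; have := main (-1) v v2; rewrite rmorphN1 mulrNN mulr1.
  move=> /(_ erefl erefl); congr (0 <= inner _ _).
  by apply/funext => p; rewrite mulN1r.
Qed.

Section FiniteFactor.
Variables (R : realType) (I J : choiceType) (F : finType).
Implicit Type rho : op R (I * J)%type.

Section Right.
Variables (e : J -> F) (g : F -> J).
Hypotheses (eK : cancel e g) (gK : cancel g e).

Let coord (p : I * J) : F := e p.2.
Let sub (p : I * J) (a : F) : I * J := (p.1, g a).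

Lemma tensor_factor_right : tensor_factor coord sub.
Proof. by split=> // -[i j]; rewrite /coord /sub /= eK. Qed.

(** Along the bijection of [J] with [F] the unordered sum over pairs becomes a finite one, and each
    [id_ketbra] becomes a matrix unit. *)
Lemma ptranspose_right (X : op R (I * J)%type) :
  ptranspose X = factor_transpose coord sub X.
Proof.
apply/funext => v; apply/funext => p; rewrite /ptranspose.
rewrite (@sum_fin _ _ _ (fun ab : F * F => (g ab.1, g ab.2))).
- have idE a b (w : I * J -> R[i]) :
      id_ketbra (g a) (g b) w = munit coord sub a b w.
    apply/funext => q; rewrite /id_ketbra /munit /ket /coord.
    by rewrite (can2_eq eK gK).
  rewrite /factor_transpose pair_bigA /=.
  by apply: eq_bigr => -[a b] _ /=; rewrite !idE.
- by move=> [a b] [c d] /= [/(can_inj gK) -> /(can_inj gK) ->].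
- by move=> [j l] H; exfalso; apply: H; exists (e j, e l); rewrite //= !eK.
Qed.

Lemma kappa_le_right rho : state rho ->
  (kappa_entanglement rho <= log2 (#|F|%:R)%:E)%E.
Proof.
apply: (@kappa_le_factor _ _ _ _ _ _ false _ tensor_factor_right) => X v _ _.
by rewrite ptranspose_right.
Qed.

End Right.

Section Left.
Variables (e : I -> F) (g : F -> I).
Hypotheses (eK : cancel e g) (gK : cancel g e).

Let coord (p : I * J) : F := e p.1.
Let sub (p : I * J) (a : F) : I * J := (g a, p.2).

Lemma tensor_factor_left : tensor_factor coord sub.
Proof. by split=> // -[i j]; rewrite /coord /sub /= eK. Qed.

(* The partial transpose on the second factor is the full transpose of the one
   on the first, and the transpose of a self-adjoint X is its entrywise
   complex conjugate. *)
Lemma ptranspose_left (X : op R (I * J)%type) v : positive X -> ell2 v ->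
  ptranspose X v =
  fun p => (factor_transpose coord sub X (fun q => (v q)^*) p)^*.
Proof.
move=> pX v2; have [bX _] := pX; apply/funext => p.
pose x a b := X (ket R (g a, p.2)) (p.1, b).
have x2 a : ell2 (x a).
  by apply: ell2_slice; apply: bounded_linear_ell2 => //; exact: ell2_ket.
have z2 a : ell2 (fun b => v (g a, b)) by exact: ell2_slice.
(* In the sum defining [ptranspose] only pairs with first entry [p.2] contribute. Expanding the
   input over the finite first factor leaves, for each [a], a sum over [b] that is an inner product
   on the second factor. *)
transitivity (\sum_a inner (fun b => (x a b)^*) (fun b => v (g a, b))).
  rewrite /ptranspose (@sum_inj _ J _ (fun b => (p.2, b))); last 2 first.
  - by move=> b b' [].
  - move=> [a b] ab; rewrite {1}/id_ketbra /ket /=.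
    case: eqP => [pa|_]; last exact: mulr0.
    by case: ab; exists b; rewrite // pa.
  apply: (@has_sum_sum _ R[i]^o).
  have := has_sum_big (fun a => inner_has_sum (ell2J (x2 a)) (z2 a)).
  congr (has_sum _ _); apply/funext => b /=.
  rewrite {1}/id_ketbra /ket eqxx mulr1.
  rewrite (_ : id_ketbra p.2 b v =
      fun m => \sum_a v (g a, b) * ket R (g a, p.2) m).
    rewrite bounded_linear_lincomb//; last by move=> a; exact: ell2_ket.
    by apply: eq_bigr => a _; rewrite conjCK mulrC.
  apply/funext => -[i j]; rewrite /id_ketbra /= (bigD1 (e i))//= big1 ?addr0.
    by rewrite eK /ket xpair_eqE eqxx.
  move=> a ai; rewrite /ket xpair_eqE -(can2_eq eK gK) eq_sym.
  by rewrite (negPf ai) mulr0.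
rewrite factor_transposeE rmorph_sum; apply: eq_bigr => a _ /=.
have w2 : ell2 (munit coord sub (coord p) a (fun q => (v q)^*)).
  apply: bounded_linear_ell2; last exact: ell2J.
  exact: munit_bounded tensor_factor_left _ _.
(* Self-adjointness moves [X] onto the basis vector, which produces the conjugated entries [x a b];
   the sum then reduces to first index [p.1]. *)
rewrite -[X _ _]inner_ket -positive_self_adjoint//; last exact: ell2_ket.
apply: (can_inj conjCK); rewrite conjCK -innerJJ//; last exact: ell2J.
rewrite [RHS](@sum_inj _ J _ (fun b => (p.1, b))).
- rewrite /inner; congr (@sum _ _ R[i]^o _); apply/funext => b /=.
  by rewrite conjCK /munit /coord /= eqxx mulr1.
- by move=> b b' [].
- move=> [i b] ib; rewrite /munit /coord /=.
  case: eqP => [pi|_]; last by rewrite !mulr0.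
  by case: ib; exists b; rewrite // (can_inj eK pi).
Qed.

Lemma kappa_le_left rho : state rho ->
  (kappa_entanglement rho <= log2 (#|F|%:R)%:E)%E.
Proof.
apply: (@kappa_le_factor _ _ _ _ _ _ true _ tensor_factor_left) => X v pX v2.
by rewrite ptranspose_left.
Qed.

End Left.

End FiniteFactor.

(** * Logarithm, dimension and the general bound *)

Lemma log2y (R : realType) : log2 (+oo%E : \bar R) = +oo%E.
Proof. by rewrite /log2 /= gt0_mulye// lte_fin invr_gt0 ln_gt0// ltr1n. Qed.

Lemma le_log2 (R : realType) (x y : \bar R) :
  (0 <= x -> x <= y -> log2 x <= log2 y)%E.
Proof.
move=> x0 xy; apply: lee_wpmul2r.
  by rewrite lee_fin invr_ge0 ln_ge0// ler1n.
by rewrite lee_lne// in_itv /= leey ?x0 ?(le_trans x0).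
Qed.

(** A [choiceType] of finite dimension need not be a [finType]; the bijection with one lets the
    finite-factor bounds apply. *)
Lemma hdim_finite (R : realType) (K : choiceType) :
  hdim R K = +oo%E \/ exists (F : finType) (e : K -> F) (g : F -> K),
    [/\ cancel e g, cancel g e & hdim R K = (#|F|%:R)%:E].
Proof.
rewrite /hdim /counting; case: asboolP => [finK|_]; last by left.
right; set A := fset_set [set: K].
have inA k : k \in A by rewrite in_fset_set//; exact: mem_set.
exists A, (fun k => FSetSub (inA k)), val; split=> [k|a|]; first by [].
  exact: val_inj.
by rewrite cardfE.
Qed.

(** The minimum is one of the two dimensions, and the bound holds for each of them: trivially if it
    is infinite, by the finite-factor bound otherwise. *)
Lemma kappa_le_log2_dim (R : realType) (I J : choiceType)
    (rho : op R (I * J)%type) :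
  state rho ->
  (kappa_entanglement rho <= log2 (Order.min (hdim R I) (hdim R J)))%E.
Proof.
move=> st; rewrite /Order.min; case: ifP => _.
  have [->|[F [e [g [eK gK ->]]]]] := hdim_finite R I.
    by rewrite log2y leey.
  exact: (kappa_le_left eK gK).
have [->|[F [e [g [eK gK ->]]]]] := hdim_finite R J.
  by rewrite log2y leey.
exact: (kappa_le_right eK gK).
Qed.

(** * The maximally entangled state *)

Section MaxEntangled.
Variables (R : realType) (M : nat).
Hypothesis M0 : (0 < M)%N.
Implicit Types (v : 'I_M * 'I_M -> R[i]) (p : 'I_M * 'I_M).

Let factorM : tensor_factor (fun p : 'I_M * 'I_M => p.2) (fun p a => (p.1, a)).
Proof. exact: (@tensor_factor_right _ _ _ id id). Qed.

Lemma sum_diag (a b : 'I_M) :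
  \sum_(i < M) ((a, b) == (i, i))%:R = (a == b)%:R :> R[i].
Proof.
rewrite (bigD1 a)//= big1 ?addr0; first by rewrite xpair_eqE eqxx eq_sym.
by move=> i ia; rewrite xpair_eqE eq_sym (negPf ia).
Qed.

Lemma max_entangledE v p :
  max_entangled v p = M%:R^-1 * ((p.1 == p.2)%:R * \sum_(j < M) v (j, j)).
Proof.
case: p => a b; congr (_ * _); rewrite -sum_diag mulr_suml.
apply: eq_bigr => i _; rewrite mulr_sumr.
by apply: eq_bigr => j _; rewrite mulrC.
Qed.

Lemma max_entangled_bounded : bounded_linear (@max_entangled R M).
Proof.
apply: bounded_linearZ; apply: bounded_linear_sum => i.
by apply: bounded_linear_sum => j; exact: bounded_linear_ketbra.
Qed.

Lemma inner_max_entangled v : ell2 v ->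
  inner v (max_entangled v) = M%:R^-1 *
    ((\sum_(i < M) v (i, i)) * (\sum_(i < M) v (i, i))^*).
Proof.
move=> v2; have k2 i j : ell2 (ketbra (i, i) (j, j) v).
  exact: bounded_linear_ell2 (bounded_linear_ketbra R _ _) v2.
rewrite /max_entangled innerZ//; last first.
  by apply: ell2_sum => i; apply: ell2_sum => j.
congr (_ * _); rewrite inner_sum//; last by move=> i; apply: ell2_sum => j.
rewrite mulrC rmorph_sum mulr_suml; apply: eq_bigr => i _.
rewrite inner_sum// mulr_sumr; apply: eq_bigr => j _.
by rewrite innerZ ?inner_ketr//=; [rewrite mulrC|exact: ell2_ket].
Qed.

Lemma max_entangled_state : state (@max_entangled R M).
Proof.
have b := max_entangled_bounded; split.
  split=> // v v2; rewrite (_ : (fun k => _) = max_entangled v); last first.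
    by apply/funext => k; rewrite /op_zero subr0.
  by rewrite inner_max_entangled// mulr_ge0 ?mul_conjC_ge0// invr_ge0.
(* The trace is a sum of [M] diagonal entries equal to the inverse of [M], all others being 0. *)
have tE p : inner (ket R p) (max_entangled (ket R p)) =
    M%:R^-1 * (p.1 == p.2)%:R.
  rewrite inner_ket max_entangledE; congr (_ * _).
  case: p => c d /=; rewrite (eq_bigr (fun i => ((c, d) == (i, i))%:R)).
    by rewrite sum_diag -natrM mulnb andbb.
  by move=> i _; rewrite /ket eq_sym.
rewrite /trace esum_finType; last first.
  move=> p; rewrite tE lee_fin -(rmorph_nat (real_complex R)) -fmorphV.
  rewrite -(rmorph_nat (real_complex R)) -rmorphM /=.
  by rewrite mulr_ge0// invr_ge0.
rewrite sumEFin -raddf_sum; congr (_%:E).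
rewrite (eq_bigr (fun p : 'I_M * 'I_M => M%:R^-1 * (p.1 == p.2)%:R)); last first.
  by move=> p _; rewrite tE.
rewrite -mulr_sumr.
rewrite (_ : \sum_(p : 'I_M * 'I_M) (p.1 == p.2)%:R =
  \sum_(i < M) \sum_(j < M) (i == j)%:R); last by rewrite pair_bigA.
rewrite (eq_bigr (fun=> 1)) => [|i _].
  by rewrite big_const_ord iter_addr_0 mulVf// pnatr_eq0 -lt0n.
rewrite (bigD1 i)//= big1 ?addr0 ?eqxx// => j.
by rewrite eq_sym => /negPf ->.
Qed.

(** The output of [max_entangled] is supported on pairs of equal indices, which leaves one term of
    the transpose, and in it one term of the sum over [j]. *)
Lemma ptranspose_max_entangled v p :
  ptranspose (@max_entangled R M) v p = M%:R^-1 * v (p.2, p.1).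
Proof.
rewrite (@ptranspose_right _ _ _ _ id id)// factor_transposeE.
case: p => a b /=; rewrite (bigD1 a)//= big1 ?addr0.
  rewrite max_entangledE /= eqxx mul1r; congr (_ * _).
  rewrite (bigD1 b)//= big1 ?addr0; first by rewrite /munit /= eqxx mulr1.
  by move=> i ib; rewrite /munit /= (negPf ib) mulr0.
by move=> i ia; rewrite max_entangledE /= eq_sym (negPf ia) mul0r mulr0.
Qed.

Lemma kappa_feasible_diag (S : op R ('I_M * 'I_M)%type) (i j : 'I_M) :
  kappa_feasible (@max_entangled R M) S ->
  2 * M%:R^-1 <= S (ket R (i, j)) (i, j) + S (ket R (j, i)) (j, i).
Proof.
move=> [[[bS _] _] opS leS].
pose p := (i, j); pose q := (j, i).
(* On a vector that the swap multiplies by 1 or by -1, the upper or the lower constraint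
   respectively says that the form of [Y] is nonnegative. *)
pose Y : op R ('I_M * 'I_M)%type :=
  fun v k => (- M%:R^-1) * v k + ptranspose S v k.
have bT : bounded_linear (ptranspose S).
  rewrite (@ptranspose_right _ _ _ _ id id)//; exact: factor_transpose_bounded.
have bY : bounded_linear Y.
  apply: bounded_linearD => //.
  apply: (@bounded_linearZ _ _ _ id); split=> //.
  by exists 1 => v _; rewrite mul1e.
have p2 : ell2 (ket R p) by exact: ell2_ket.
have q2 : ell2 (ket R q) by exact: ell2_ket.
have YE k : inner (ket R k) (Y (ket R k)) = - M%:R^-1 + S (ket R k) k.
  rewrite inner_ket /Y (@ptranspose_right _ _ _ _ id id)//.
  rewrite factor_transpose_diag//.
  by rewrite {1}/ket eqxx mulr1.
have ketS k (l : 'I_M * 'I_M) : ket R (k.2, k.1) (l.2, l.1) = ket R k l.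
  by case: k l => a b [c d]; rewrite /ket !xpair_eqE andbC.
have Y0 (c : R[i]) : c = 1 \/ c = -1 ->
    0 <= inner (fun k => c * ket R p k + ket R q k)
           (Y (fun k => c * ket R p k + ket R q k)).
  move=> cE; set v := fun k => _.
  have v2 : ell2 v by exact: ell2ZD.
  have vS (k : 'I_M * 'I_M) : v (k.2, k.1) = c * v k.
    rewrite /v -(ketS p) -(ketS q) /=.
    rewrite -[(j, i)]/q -[(i, j)]/p mulrDr mulrA addrC.
    by congr (_ + _); case: cE => ->; rewrite ?mulrNN ?mulr1 !mul1r.
  case: cE => cE; [have := leS v v2|have := opS v v2];
    congr (0 <= inner _ _); apply/funext => k;
    rewrite /Y /op_opp ptranspose_max_entangled vS cE; ring.
(* The cross terms [x] and [y] cancel in the sum of the two cases; only diagonal entries remain, and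
   these the partial transpose preserves. *)
have := addr_ge0 (Y0 1 (or_introl erefl)) (Y0 (-1) (or_intror erefl)).
rewrite !innerZD_form// !YE rmorphN1 rmorph1.
set x := inner _ _; set y := inner _ _; set s := S _ _; set t := S _ _.
set m := M%:R^-1.
rewrite (_ : _ + _ = 2 * ((s + t) - 2 * m)); last by ring.
by rewrite pmulr_rge0 ?ltr0n// subr_ge0.
Qed.

Lemma kappa_feasible_trace (S : op R ('I_M * 'I_M)%type) :
  kappa_feasible (@max_entangled R M) S -> ((M%:R)%:E <= trace S)%E.
Proof.
move=> fS; have [[posS _] _ _] := fS.
pose t p : R := complex.Re (S (ket R p) p).
have trE : trace S = (\sum_(p : 'I_M * 'I_M) t p)%:E.
  rewrite /trace esum_finType.
    by rewrite sumEFin; congr (_%:E); apply: eq_bigr => p _; rewrite inner_ket.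
  move=> p; rewrite lee_fin.
  by have := positive_inner_ge0 posS (ell2_ket R p); rewrite lecE => /andP[].
have t2 i j : 2 * M%:R^-1 <= t (i, j) + t (j, i).
  have := kappa_feasible_diag i j fS; rewrite lecE => /andP[_].
  rewrite raddfD /=; apply: le_trans.
  rewrite -(rmorph_nat (real_complex R) M) -(rmorph_nat (real_complex R) 2).
  by rewrite -fmorphV -rmorphM.
(* Over all ordered pairs the left side adds up to [2 * M], and the right side counts each diagonal
   entry of [S] twice. *)
have : \sum_(i < M) \sum_(j < M) (2 * M%:R^-1) <=
    \sum_(i < M) \sum_(j < M) (t (i, j) + t (j, i)).
  by apply: ler_sum => i _; apply: ler_sum => j _.
rewrite !big_const_ord !iter_addr_0 -!mulrnA.
under [leRHS]eq_bigr do rewrite big_split.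
rewrite big_split /= [X in _ + X]exchange_big /= trE lee_fin.
have -> : \sum_(i < M) \sum_(j < M) t (i, j) = \sum_(p : 'I_M * 'I_M) t p.
  by rewrite pair_bigA; apply: eq_bigr => -[].
rewrite -[leLHS]mulr_natr natrM -mulrA [M%:R^-1 * _]mulrA.
rewrite mulVf ?pnatr_eq0 -?lt0n// mul1r.
lra.
Qed.

(** The upper bound is the dimension bound for the second factor; the lower one is the trace bound,
    since [log2] is monotone. *)
Lemma kappa_max_entangled :
  kappa_entanglement (@max_entangled R M) = log2 (M%:R)%:E.
Proof.
apply/eqP; rewrite eq_le; apply/andP; split.
  have := @kappa_le_right R _ _ _ id id _ _ _ max_entangled_state.
  by rewrite card_ord; apply.
apply/ereal_infP => _ [S fS <-]; apply: le_log2; first by rewrite lee_fin.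
exact: kappa_feasible_trace.
Qed.

End MaxEntangled.

Theorem proposition9 (R : realType) :
  (forall M : nat, (0 < M)%N ->
     kappa_entanglement (@max_entangled R M) = log2 (M%:R)%:E) /\
  (forall (I J : choiceType) (rho : op R (I * J)%type),
     state rho ->
     (kappa_entanglement rho <= log2 (Order.min (hdim R I) (hdim R J)))%E).
Proof.
split=> [M M0|I J rho]; first exact: kappa_max_entangled.
exact: kappa_le_log2_dim.
Qed.
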